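(* Let $k>1$, let $U_1\in\mathbb{F}_q^{k\times k}$, $U_2\in\mathbb{F}_q^{k\times(k+1)}$ with $\mathrm{rk}(U_1)=\mathrm{rk}(U_2)=k$, and let $\mathbf{v}_1\in\mathbb{F}_q^k$, $\mathbf{v}_2\in\mathbb{F}_q^{k+1}\setminus\mathrm{rowsp}(U_2)$. Define $\mathcal{U}=\mathrm{rowsp}(U_1\mid U_2)$, $\mathcal{U}'=\mathrm{rowsp}(U_1\mid 0_{k\times(k+1)})$, $\mathcal{U}''=\mathrm{rowsp}(0_{k\times k}\mid U_2)$, $\mathcal{V}=\mathrm{rowsp}\begin{pmatrix}U_1&U_2\\ \mathbf{v}_1&\mathbf{v}_2\end{pmatrix}$, $\mathcal{V}'=\mathrm{rowsp}\begin{pmatrix}U_1&0_{k\times(k+1)}\\ \mathbf{v}_1&\mathbf{v}_2\end{pmatrix}$, $\mathcal{V}''=\mathrm{rowsp}\begin{pmatrix}0_{k\times k}&U_2\\ \mathbf{v}_1&\mathbf{v}_2\end{pmatrix}$. Let $\mathcal{F},\mathcal{F}',\mathcal{F}''$ be full flags on $\mathbb{F}_q^{2k+1}$ with $\mathcal{F}_k=\mathcal{U}$, $\mathcal{F}_{k+1}=\mathcal{V}$, $\mathcal{F}'_k=\mathcal{U}'$, $\mathcal{F}'_{k+1}=\mathcal{V}'$, $\mathcal{F}''_k=\mathcal{U}''$, $\mathcal{F}''_{k+1}=\mathcal{V}''$. Then the flag code $\mathcal{C}=\mathrm{Orb}_{\mathbf{G}}(\mathcal{F})\cup\{\mathcal{F}',\mathcal{F}''\}$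 is an optimum distance flag code with cardinality $q^{k+1}+1$ if and only if $\mathbf{v}_1=\mathbf{0}_k$.
   Context: Let $M_{k+1}\in\mathrm{GL}(k+1,q)$ be the companion matrix of a primitive polynomial of degree $k+1$ over $\mathbb{F}_q$, let $g=\begin{pmatrix}I_k&0\\0&M_{k+1}\end{pmatrix}\in\mathrm{GL}(2k+1,q)$ and $\mathbf{G}=\langle g\rangle$. A full flag on $\mathbb{F}_q^{2k+1}$ is a chain $\mathcal{F}_1\subsetneq\cdots\subsetneq\mathcal{F}_{2k}$ of subspaces with $\dim\mathcal{F}_i=i$. $\mathrm{GL}(2k+1,q)$ acts on subspaces by $\mathcal{V}\cdot A=\mathrm{rowsp}(VA)$ and on flags componentwise. With $d_S(\mathcal{A},\mathcal{B})=\dim(\mathcal{A}+\mathcal{B})-\dim(\mathcal{A}\cap\mathcal{B})$ and $d_f(\mathcal{F},\mathcal{F}')=\sum_i d_S(\mathcal{F}_i,\mathcal{F}'_i)$, a flag code $\mathcal{C}$ of type $(t_1,\dots,t_r)$ on $\mathbb{F}_q^n$ is an optimum distance flag code if its minimum flag distance between distinct members ($0$ if $|\mathcal{C}|=1$) equals $2\left(\sum_{2t_i\leq n}t_i+\sum_{2t_i>n}(n-t_i)\right)$. *)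

(* Defs.v *)
From HB Require Import structures.
From mathcomp Require Import all_boot all_order all_algebra all_fingroup all_field.

Set Implicit Arguments.
Unset Strict Implicit.
Unset Printing Implicit Defensive.

Import GRing.Theory.
Local Open Scope ring_scope.

(* {'GL_n[F]} consists of matrices of size n.-1.+1; for 0 < n this is n and
   [conform_mx] only transports the matrix along that equality. *)
Definition GLmx (F : finFieldType) (n : nat) (A : {'GL_n[F]}) : 'M[F]_n :=
  conform_mx 1%:M (GLval A).

Section GLmxTheory.

Variables (F : finFieldType) (n : nat).
Implicit Types A B : {'GL_n[F]}.

Lemma GLmx1 : GLmx (1%g : {'GL_n[F]}) = 1%:M.
Proof.
rewrite /GLmx; case: n => [|m]; first by apply/matrixP => -[].
by rewrite conform_mx_id.
Qed.

Lemma GLmxM A B : GLmx (A * B)%g = GLmx A *m GLmx B.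
Proof.
rewrite /GLmx; case: n A B => [|m] A B; first by apply/matrixP => -[].
by rewrite !conform_mx_id.
Qed.

Lemma GLmxK A : GLmx A *m GLmx A^-1%g = 1%:M.
Proof. by rewrite -GLmxM mulgV GLmx1. Qed.

Lemma GLmxKV A : GLmx A^-1%g *m GLmx A = 1%:M.
Proof. by rewrite -GLmxM mulVg GLmx1. Qed.

End GLmxTheory.

(* A subspace of F^n is represented by the canonical square matrix <<V>>%MS,
   so that equality of subspaces is equality of matrices. A flag is recorded
   as the tuple of its (nonzero, proper) subspaces. *)
Definition is_flag (F : finFieldType) (n : nat) (t : seq nat)
    (W : (size t).-tuple 'M[F]_n) : bool :=
  [&& all (fun V => <<V>>%MS == V) W,
      path (fun U V => (U < V)%MS) 0 (rcons W 1%:M)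
    & map (fun V => \rank V) W == t].

Record flag (F : finFieldType) (n : nat) (t : seq nat) := Flag {
  flag_val :> (size t).-tuple 'M[F]_n;
  flagP : is_flag flag_val
}.

HB.instance Definition _ (F : finFieldType) (n : nat) (t : seq nat) :=
  [isSub for @flag_val F n t].
HB.instance Definition _ (F : finFieldType) (n : nat) (t : seq nat) :=
  [Finite of flag F n t by <:].

Definition full_flag (F : finFieldType) (n : nat) := flag F n (iota 1 n.-1).

(* The i-th subspace W_i, numbered from 1. *)
Definition flag_nth (F : finFieldType) (n : nat) (t : seq nat)
    (W : flag F n t) (i : nat) : 'M[F]_n := W`_i.-1.

Section FlagAction.

Variables (F : finFieldType) (n : nat) (t : seq nat).
Implicit Types (W : flag F n t) (A B : {'GL_n[F]}).

Definition flag_act_val W A : (size t).-tuple 'M[F]_n :=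
  [tuple of [seq <<V *m GLmx A>>%MS | V : 'M[F]_n <- W]].

Lemma submx_GLmx m1 m2 (U : 'M[F]_(m1, n)) (V : 'M[F]_(m2, n)) A :
  (<<U *m GLmx A>> <= <<V *m GLmx A>>)%MS = (U <= V)%MS.
Proof.
rewrite !genmxE; apply/idP/idP => [|/submxMr-> //].
move/(submxMr (GLmx A^-1%g)).
by rewrite -!mulmxA GLmxK !mulmx1.
Qed.

Lemma flag_act_subproof W A : is_flag (flag_act_val W A).
Proof.
case/and3P: (flagP W) => _ cW rW; apply/and3P; split.
- by apply/allP => _ /mapP[V _ ->]; rewrite genmx_id.
- pose f (V : 'M[F]_n) := <<V *m GLmx A>>%MS.
  have f0 : f 0 = 0 by rewrite /f mul0mx genmx0.
  have f1 : f 1%:M = 1%:M.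
    rewrite /f mul1mx -[RHS]genmx1; apply/eq_genmx/eqmxP.
    by rewrite submx1 -(GLmxKV A) submxMl.
  rewrite -[X in path _ X]f0 -[X in rcons _ X]f1 /= -map_rcons path_map.
  by apply: sub_path cW => U V; rewrite /= /ltmx !submx_GLmx.
- rewrite -[X in _ == X](eqP rW) -map_comp; apply/eqP/eq_map => V /=.
  by rewrite genmxE mxrankMfree // /row_free -[X in _ == X](mxrank1 F) eqn_leq
    (mxrank1 F) rank_leq_row -{1}(mxrank1 F n) -(GLmxK A) mxrankM_maxl.
Qed.

Definition flag_act W A : flag F n t := Flag (flag_act_subproof W A).

Lemma flag_act1 W : flag_act W 1%g = W.
Proof.
apply/val_inj/val_inj => /=; case/and3P: (flagP W) => /allP gW _ _.
rewrite -[RHS]map_id; apply/eq_in_map => V /gW /eqP {2}<-.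
by rewrite GLmx1 mulmx1.
Qed.

Lemma flag_actM W A B : flag_act W (A * B)%g = flag_act (flag_act W A) B.
Proof.
apply/val_inj/val_inj => /=; rewrite -map_comp; apply/eq_map => V /=.
rewrite GLmxM mulmxA; apply/eq_genmx.
by apply: eqmx_sym; apply: eqmxMr; apply: genmxE.
Qed.

Canonical flag_action := TotalAction flag_act1 flag_actM.

End FlagAction.

Definition subspace_dist (F : finFieldType) (n : nat) (U V : 'M[F]_n) : nat :=
  (\rank (U + V)%MS - \rank (U :&: V)%MS)%N.

Definition flag_dist (F : finFieldType) (n : nat) (t : seq nat)
    (W W' : flag F n t) : nat :=
  (\sum_(i < size t) subspace_dist (tnth W i) (tnth W' i))%N.

Definition min_flag_dist (F : finFieldType) (n : nat) (t : seq nat)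
    (C : {set flag F n t}) : nat :=
  let P := [pred e : flag F n t * flag F n t |
              [&& e.1 \in C, e.2 \in C & e.1 != e.2]] in
  let d (e : flag F n t * flag F n t) := flag_dist e.1 e.2 in
  if [pick e | P e] is Some e0 then d [arg min_(e < e0 | P e) d e] else 0%N.

Definition optimum_distance (F : finFieldType) (n : nat) (t : seq nat)
    (C : {set flag F n t}) : Prop :=
  min_flag_dist C =
    (2 * (\sum_(i <- t | 2 * i <= n) i + \sum_(i <- t | 2 * i > n) (n - i)))%N.

(* Main.v *)
From HB Require Import structures.
Require Import Defs.
From mathcomp Require Import all_boot all_order all_algebra all_fingroup all_field.
From mathcomp Require Import cyclic zify.

Set Implicit Arguments.
Unset Strict Implicit.
Unset Printing Implicit Defensive.

Import GRing.Theory.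
Local Open Scope ring_scope.

(* The flag distance of two full flags is maximal exactly when their k-th
   subspaces meet trivially and their (k+1)-st subspaces span the whole space,
   so only these two levels matter. If v1 = 0, both properties follow from the
   invertibility of M^i and of M^i - M^j in the field F[M], and the stabilizer
   of the flag in <g> is trivial. If v1 <> 0, write v1 = w U1 and put b = w U2,
   a = v2 - b, and let phi be a linear form with kernel U2. The forms
   z |-> phi (a z) and z |-> phi (b z) on F[M] are linearly independent, so
   some z satisfies phi (a z) = 0 and phi (b z) = phi v2; by primitivity z is a
   power M^i, and the linear form (x, y) |-> phi (y - x U1^-1 U2 M^i) vanishes
   on both V g^i and V'', which therefore do not span. *)

(** * Row spaces: trivial intersections, spanning sums, hyperplanes *)

Section RowSpaces.

Variable F : fieldType.

Lemma mulmx_row_free_eq0 m n p (A : 'M[F]_(m, n)) (a : 'M_(p, m)) :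
  row_free A -> a *m A = 0 -> a = 0.
Proof. by move=> freeA aA0; apply: (row_free_inj freeA); rewrite mul0mx. Qed.

Lemma mulmx_row_full_eq0 m n p (A : 'M[F]_(m, n)) (h : 'M_(n, p)) :
  row_full A -> A *m h = 0 -> h = 0.
Proof. by move=> fullA Ah0; apply: (row_full_inj fullA); rewrite mulmx0. Qed.

Lemma row_full_by_cokernel m n (A : 'M[F]_(m, n)) :
  (forall h : 'M_n, A *m h = 0 -> h = 0) -> row_full A.
Proof.
by move=> /(_ _ (mulmx_coker A)) cA; rewrite -sub1mx submxE cA mulmx0.
Qed.

(** Each row of the intersection is a combination of both families; comparing left and right blocks
    gives the two equations on the coefficients. *)
Lemma capmx_row_mx_eq0 m1 m2 n1 n2 (A : 'M[F]_(m1, n1)) (B : 'M_(m1, n2))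
    (A' : 'M_(m2, n1)) (B' : 'M_(m2, n2)) :
  (forall p (a : 'M_(p, m1)) (b : 'M_(p, m2)),
     a *m A = b *m A' -> a *m B = b *m B' -> a = 0) ->
  (row_mx A B :&: row_mx A' B')%MS = 0.
Proof.
move=> AB0; apply/eqP; rewrite -submx0.
have /submxP[a capE] := capmxSl (row_mx A B) (row_mx A' B').
have /submxP[b] := capmxSr (row_mx A B) (row_mx A' B').
rewrite capE !mul_mx_row => /eq_row_mx[eA eB].
by rewrite (AB0 _ _ _ eA eB) !mul0mx row_mx0 sub0mx.
Qed.

(** A sum is the whole space once no nonzero linear form, here [col_mx h l], vanishes on both
    summands. *)
Lemma row_full_adds_block m1 m2 m3 m4 n1 n2
    (A : 'M[F]_(m1, n1)) (B : 'M_(m1, n2)) (C : 'M_(m2, n1)) (D : 'M_(m2, n2))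
    (A' : 'M_(m3, n1)) (B' : 'M_(m3, n2)) (C' : 'M_(m4, n1))
    (D' : 'M_(m4, n2)) :
  (forall p (h : 'M_(n1, p)) (l : 'M_(n2, p)),
     [/\ A *m h + B *m l = 0, C *m h + D *m l = 0,
         A' *m h + B' *m l = 0 & C' *m h + D' *m l = 0] -> h = 0 /\ l = 0) ->
  row_full (block_mx A B C D + block_mx A' B' C' D')%MS.
Proof.
move=> ker0; rewrite -sub1mx addsmxE sub1mx; apply: row_full_by_cokernel => h.
rewrite -[h]vsubmxK mul_col_mx !mul_block_col => /eqP.
rewrite !col_mx_eq0 => /andP[/andP[/eqP e1 /eqP e2] /andP[/eqP e3 /eqP e4]].
by case: (ker0 _ _ _ (And4 e1 e2 e3 e4)) => -> ->; rewrite col_mx0.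
Qed.

Lemma row_full_adds_cokernel m1 m2 n p (A : 'M[F]_(m1, n)) (B : 'M_(m2, n))
    (h : 'M_(n, p)) :
  row_full (A + B)%MS -> A *m h = 0 -> B *m h = 0 -> h = 0.
Proof.
rewrite -sub1mx addsmxE sub1mx => fullAB Ah Bh.
by apply: (mulmx_row_full_eq0 fullAB); rewrite mul_col_mx Ah Bh col_mx0.
Qed.

(** The annihilator [kermx U^T] has rank one: any nonzero row of it defines the hyperplane, and
    every other form vanishing on [U] is a multiple. *)
Lemma hyperplane_eqn n (U : 'M[F]_(n, n.+1)) :
  \rank U = n -> exists2 phi : 'cV[F]_n.+1, phi != 0 &
    (forall m (x : 'M_(m, n.+1)), (x <= U)%MS = (x *m phi == 0)) /\
    (forall psi : 'cV_n.+1, U *m psi = 0 -> exists c, psi = c *: phi).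
Proof.
move=> rU; pose K := kermx U^T.
have rK : \rank K = 1%N by rewrite mxrank_ker mxrank_tr rU subSnn.
pose v := nz_row K.
have vn0 : v != 0 by rewrite nz_row_eq0 -mxrank_eq0 rK.
have vK : (v <= K)%MS by exact: nz_row_sub.
have Uv : U *m v^T = 0.
  by apply: trmx_inj; rewrite trmx_mul trmxK trmx0; apply/sub_kermxP.
have rv : \rank v = 1%N by rewrite rank_rV vn0.
exists v^T; first by rewrite -(trmx0 F) (inj_eq trmx_inj).
split=> [m x | psi Upsi].
  have UK : (U <= kermx v^T)%MS by apply/sub_kermxP.
  have rUK : \rank U = \rank (kermx v^T).
    by rewrite mxrank_ker mxrank_tr rv rU subn1.
  have eqU : (U == kermx v^T)%MS.
    by rewrite -(mxrank_leqif_eq UK) rUK.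
  by rewrite (eqmxP eqU) sub_kermx.
have psiK : (psi^T <= K)%MS.
  by apply/sub_kermxP; rewrite -trmx_mul Upsi trmx0.
have eqK : (v == K)%MS by rewrite -(mxrank_leqif_eq vK) rK rv.
move: psiK; rewrite -(eqmxP eqK) => /sub_rVP[c cE].
by exists c; apply: trmx_inj; rewrite cE linearZ /= trmxK.
Qed.

End RowSpaces.

(** * The field F[M] for an irreducible characteristic polynomial *)

Section IrreducibleCharPoly.

Variables (F : fieldType) (n : nat) (M : 'M[F]_n.+1).
Hypothesis charM_irr : irreducible_poly (char_poly M).

Lemma horner_mx_eq0 q : (horner_mx M q == 0) = (char_poly M %| q).
Proof.
rewrite -dvd_mxminpoly; apply/eqp_dvdl.
apply: charM_irr.2; last exact: mxminpoly_dvd_char.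
by rewrite size_mxminpoly eqSS -lt0n mxminpoly_nonconstant.
Qed.

(** A Bezout relation between [q] and the characteristic polynomial, evaluated at [M], yields the
    inverse by Cayley-Hamilton. *)
Lemma horner_mx_unitmx q : horner_mx M q != 0 -> horner_mx M q \in unitmx.
Proof.
rewrite horner_mx_eq0 -irreducible_poly_coprime //.
case/Bezout_eq1_coprimepP=> -[u v] /= uvE.
have /mulmx1_unit[]// : horner_mx M v *m horner_mx M q = 1%:M.
rewrite -[1%:M](rmorph1 (horner_mx M)) -uvE rmorphD !rmorphM /=.
by rewrite Cayley_Hamilton mulr0 add0r.
Qed.

(** The space is one-dimensional over F[M]: sending a polynomial of size at most [n.+1] to its value
    at [M] applied to [a] is linear between spaces of equal dimension, so injectivity gives
    surjectivity. *)
Lemma horner_mx_transitive (a y : 'rV[F]_n.+1) :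
  a != 0 -> exists q, y = a *m horner_mx M q.
Proof.
move=> an0.
pose f (x : 'rV[F]_n.+1) := a *m horner_mx M (rVpoly x).
have linf : linear f.
  by move=> c x z; rewrite /f linearP linearP /= mulmxDr scalemxAr.
pose fL : {linear 'rV[F]_n.+1 -> 'rV[F]_n.+1} :=
  HB.pack f (GRing.isLinear.Build _ _ _ _ f linf).
have fE x : x *m lin1_mx fL = f x by rewrite mul_rV_lin1.
have full : row_full (lin1_mx fL).
  rewrite row_full_unit -row_free_unit -kermx_eq0 -submx0.
  apply/rV_subP => x /sub_kermxP; rewrite fE /f => x0.
  have : horner_mx M (rVpoly x) == 0.
    apply: contraT => /horner_mx_unitmx ux; case/eqP: an0.
    by apply: (mulmx_row_free_eq0 _ x0); rewrite row_free_unit.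
  (* The characteristic polynomial has size [n.+2], too large to divide a nonzero [rVpoly x]. *)
  rewrite horner_mx_eq0 => /(dvdp_leq _); rewrite size_char_poly.
  case: (eqVneq (rVpoly x) 0) => [x0' _|xn0 /(_ isT)].
    by rewrite -[x]rVpolyK x0' linear0 sub0mx.
  by move/leq_trans/(_ (size_poly _ _)); rewrite ltnn.
have /submxP[x ->] : (y <= lin1_mx fL)%MS by exact: submx_full.
by exists (rVpoly x); rewrite fE.
Qed.

End IrreducibleCharPoly.

Lemma char_poly_castmx (R : nzRingType) m n (e : m = n) (A : 'M[R]_m) :
  char_poly (castmx (e, e) A) = char_poly A.
Proof. by case: n / e; rewrite castmx_id. Qed.

(** * Powers of a matrix with primitive characteristic polynomial *)

Section PrimitiveCharPoly.

Variables (F : finFieldType) (n : nat) (M : 'M[F]_n.+1).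
Hypotheses (n_gt0 : (0 < n)%N) (primM : primitive_poly (char_poly M)).

Let charM_irr : irreducible_poly (char_poly M).
Proof. by case/primitive_polyP: primM => -[]. Qed.

Let dvd_expmx_sub1 i : (char_poly M %| 'X^i - 1) = (M ^+ i == 1).
Proof.
by rewrite -horner_mx_eq0 // rmorphB rmorphXn rmorph1 /= horner_mx_X subr_eq0.
Qed.

Let card_qpolyM : #|{poly %/ char_poly M}|.-1 = (#|F| ^ n.+1).-1.
Proof. by rewrite card_primitive_qpoly // size_char_poly. Qed.

Lemma expmx_primitive : M ^+ (#|F| ^ n.+1).-1 = 1.
Proof.
apply/eqP; rewrite -dvd_expmx_sub1 -card_qpolyM.
by case/primitive_polyP: primM.
Qed.

Lemma expmx_primitive_neq1 i : (0 < i < (#|F| ^ n.+1).-1)%N -> M ^+ i != 1.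
Proof.
rewrite -dvd_expmx_sub1 -card_qpolyM.
by case/primitive_polyP: primM => _ _; apply.
Qed.

(** By primitivity the class of ['X] generates the nonzero residues modulo [char_poly M]; [plogp] is
    the discrete logarithm to that base. *)
Lemma horner_mx_primitive q :
  horner_mx M q != 0 -> exists i, horner_mx M q = M ^+ i.
Proof.
rewrite horner_mx_eq0 // => ndvd; exists (plogp (char_poly M) q).
apply/eqP; rewrite -subr_eq0 -[X in X ^+ _]horner_mx_X -rmorphXn -rmorphB.
by rewrite horner_mx_eq0 // plogp_X // size_char_poly.
Qed.

Lemma expmx_primitive_unit i : M ^+ i \in unitmx.
Proof.
rewrite -[M in M ^+ _]horner_mx_X -rmorphXn; apply: horner_mx_unitmx => //.
rewrite horner_mx_eq0 //; apply: contraTN (dvdpp (char_poly M)) => dvdX.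
have /eqP : horner_mx M 'X^i == 0 by rewrite horner_mx_eq0.
rewrite rmorphXn /= horner_mx_X => Mi0.
have : M ^+ (i * (#|F| ^ n.+1).-1) = 1.
  by rewrite mulnC exprM expmx_primitive expr1n.
(* As [0 ^+ 0 = 1], the exponent must be shown nonzero, which follows from [1 < #|F|]. *)
rewrite exprM Mi0 expr0n; case: eqP => [e _|_ /esym/eqP].
  2: by rewrite oner_eq0.
have := ltn_exp2l 0 n.+1 (finNzRing_gt1 F).
by rewrite expn0 ltnNge -subn_eq0 subn1 e.
Qed.

Lemma expmx_primitive_sub_unit i j :
  M ^+ i != M ^+ j -> M ^+ i - M ^+ j \in unitmx.
Proof.
have -> : M ^+ i - M ^+ j = horner_mx M ('X^i - 'X^j).
  by rewrite rmorphB !rmorphXn /= horner_mx_X.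
rewrite -subr_eq0 => neq; apply: horner_mx_unitmx => //.
by rewrite rmorphB !rmorphXn /= horner_mx_X.
Qed.

(* If phi has kernel U and b = a c with c in F[M], then phi and c phi are
   linearly independent: otherwise c is a scalar and a would lie in U. *)
Lemma expmx_hyperplane (U : 'M[F]_(n, n.+1)) (v b : 'rV_n.+1) :
  \rank U = n -> ~~ (v <= U)%MS -> (b <= U)%MS -> b != 0 ->
  exists i, ((v - b) *m M ^+ i <= U)%MS /\ (v - b *m M ^+ i <= U)%MS.
Proof.
move=> rU vnU bU bn0.
have [phi phin0 [inU Uphi]] := hyperplane_eqn rU.
pose a := v - b.
have anU : ~~ (a <= U)%MS.
  by apply: contra vnU => aU; rewrite -[v](subrK b) addmx_sub.
have an0 : a != 0 by apply: contraNneq anU => ->; exact: sub0mx.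
have [c bE] := horner_mx_transitive charM_irr b an0.
set C := horner_mx M c in bE.
have UCphi : U *m (C *m phi) != 0.
  (* If the form vanishes on [U], then [C - l] kills [phi]; a singular element of the field F[M] is
     zero, so [b] is [l] times [a]. *)
  apply: contraNneq anU => /Uphi[l Cphi].
  have C_l : horner_mx M (c - l%:P) *m phi = 0.
    by rewrite rmorphB /= horner_mx_C mulmxBl Cphi mul_scalar_mx subrr.
  have /eqP : horner_mx M (c - l%:P) == 0.
    apply: contraNT phin0 => /(horner_mx_unitmx charM_irr) uC.
    by apply/eqP/(mulmx_row_full_eq0 _ C_l); rewrite row_full_unit.
  rewrite rmorphB /= horner_mx_C => /eqP; rewrite subr_eq0 => /eqP CE.
  move: bU bn0; rewrite bE /C CE mul_mx_scalar scalemx_eq0 negb_or.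
  by move=> alU /andP[ln0 _]; rewrite -(eqmx_scale _ ln0).
have [j Uj] : exists j, row j U *m (C *m phi) != 0.
  apply/existsP; apply: contraNT UCphi; rewrite negb_exists => /forallP U0.
  by apply/eqP/row_matrixP => j; rewrite row_mul row0; apply/eqP/negPn/U0.
pose s := (row j U *m (C *m phi)) 0 0.
have sn0 : s != 0.
  by apply: contraNneq Uj => s0; rewrite [_ *m _]mx11_scalar -/s s0 raddf0.
(* A row of [U] is scaled so that the form [C *m phi] takes the value of [phi] at [v]. Writing [y]
   as [a] times an element of F[M] then gives the required power. *)
pose y := ((v *m phi) 0 0 / s) *: row j U.
have yU : (y <= U)%MS by rewrite scalemx_sub // row_sub.
have yC : y *m C *m phi = v *m phi.
  rewrite -mulmxA -scalemxAl [_ *m (C *m phi)]mx11_scalar -/s scale_scalar_mx.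
  by rewrite divfK // -mx11_scalar.
have [z yE] := horner_mx_transitive charM_irr y an0.
have zn0 : horner_mx M z != 0.
  apply: contraNneq vnU => z0; rewrite inU -yC yE z0.
  by rewrite mulmx0 !mul0mx.
have [i zE] := horner_mx_primitive zn0; exists i; split.
  by rewrite -zE -yE.
(* Elements of F[M] commute, so [b z = a c z = y c], on which [phi] agrees with [v]. *)
rewrite inU mulmxBl -yC yE bE -zE -!mulmxA (mulmxA _ _ phi) (mulmxA C).
by rewrite [horner_mx M z *m C]comm_horner_mx2 subrr.
Qed.

End PrimitiveCharPoly.

(** With s the dimension of the sum, the dimension formula makes the distance 2(s - i), and s is at
    most min(2i, n). *)
Lemma subspace_dist_leqif (F : finFieldType) n i (U V : 'M[F]_n) :
  \rank U = i -> \rank V = i ->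
  (subspace_dist U V <= 2 * minn i (n - i)
     ?= iff (\rank (U + V)%MS == minn (2 * i) n))%N.
Proof.
move=> rU rV; have := mxrank_sum_cap U V; rewrite rU rV => sumE.
have := rank_leq_col (U + V)%MS; have := mxrankS (addsmxSl U V).
rewrite /subspace_dist rU.
move: (\rank (U + V)%MS) (\rank (U :&: V)%MS) sumE => s c sumE leis lesn.
by apply/leqifP; case: eqP => ?; [apply/eqP|]; lia.
Qed.

(** * Full flags and their maximal distance *)

Section FullFlags.

Variables (F : finFieldType) (n : nat).
Implicit Types (W : full_flag F n) (A : {'GL_n[F]}).

Lemma size_full_flag W : size W = n.-1.
Proof. by rewrite size_tuple size_iota. Qed.

Lemma rank_flag_nth W i : (0 < i < n)%N -> \rank (flag_nth W i) = i.
Proof.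
case: i => // i; rewrite /= => lt_in; have lt_i : (i < n.-1)%N by lia.
case/and3P: (flagP W) => _ _ /eqP/(congr1 (fun s => s`_i)).
rewrite (nth_map 0) ?size_full_flag // nth_iota // => ->.
Qed.

Lemma flag_nthS W i j :
  (0 < i)%N -> (i <= j)%N -> (j < n)%N -> (flag_nth W i <= flag_nth W j)%MS.
Proof.
case: i j => [|i] [|j] // _; rewrite ltnS /= => le_ij lt_jn.
case/and3P: (flagP W) => _ chainW _.
have sortW : sorted (fun U V : 'M[F]_n => (U <= V)%MS) W.
  move: chainW; rewrite rcons_path => /andP[/path_sorted chainW _].
  by apply: sub_sorted chainW => U V /ltmxW.
have trans_sub : transitive (fun U V : 'M[F]_n => (U <= V)%MS).
  by move=> V U X; apply: submx_trans.
have refl_sub : reflexive (fun U V : 'M[F]_n => (U <= V)%MS).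
  by move=> U; exact: submx_refl.
by apply: (sorted_leq_nth trans_sub refl_sub) => //;
  rewrite inE size_full_flag; lia.
Qed.

Lemma flag_nth_act W A i : (0 < i < n)%N ->
  flag_nth (flag_act W A) i = <<flag_nth W i *m GLmx A>>%MS.
Proof.
case: i => // i lt_in.
by rewrite /flag_nth /= (nth_map 0) // size_full_flag; lia.
Qed.

End FullFlags.

(** The optimum value is the sum of 2 min(i, n - i) over the levels, so the levelwise bounds add up,
    with equality exactly when every level attains its bound. *)
Lemma flag_dist_leqif (F : finFieldType) n (t := iota 1 n.-1)
    (W W' : full_flag F n) :
  (flag_dist W W' <= 2 * (\sum_(i <- t | 2 * i <= n) i +
                          \sum_(i <- t | 2 * i > n) (n - i))
     ?= iff [forall i : 'I_(size t),
               \rank (flag_nth W i.+1 + flag_nth W' i.+1)%MS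
                 == minn (2 * i.+1) n])%N.
Proof.
have -> : (2 * (\sum_(i <- t | 2 * i <= n) i +
                \sum_(i <- t | 2 * i > n) (n - i)) =
           \sum_(i < size t) 2 * minn i.+1 (n - i.+1))%N.
  rewrite big_mkcond [X in (_ * (_ + X))%N]big_mkcond -big_split big_distrr /=.
  rewrite (big_nth 0) big_mkord; apply: eq_bigr => i _.
  have lt_i : (i < n.-1)%N by have := ltn_ord i; rewrite {2}size_iota.
  rewrite nth_iota // add1n.
  have minE j : (2 * ((if 2 * j <= n then j else 0) +
                      (if n < 2 * j then n - j else 0)) =
                 2 * minn j (n - j))%N by case: (leqP (2 * j) n) => ?; lia.
  exact: minE.
apply: leqif_sum => i _.
have lt_i : (0 < i.+1 < n)%N by have := ltn_ord i; rewrite {2}size_iota; lia.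
rewrite !(tnth_nth 0).
exact: subspace_dist_leqif (rank_flag_nth W lt_i) (rank_flag_nth W' lt_i).
Qed.

(* Opposite k- and (k+1)-dimensional subspaces force the opposition of the
   smaller and of the larger ones respectively. *)
Lemma flag_dist_middle (F : finFieldType) k (k_gt0 : (0 < k)%N)
    (t := iota 1 (k + k.+1).-1) (W W' : full_flag F (k + k.+1)) :
  (flag_dist W W' == 2 * (\sum_(i <- t | 2 * i <= k + k.+1) i +
                          \sum_(i <- t | 2 * i > k + k.+1) (k + k.+1 - i)))%N =
  ((flag_nth W k :&: flag_nth W' k)%MS == 0) &&
  row_full (flag_nth W k.+1 + flag_nth W' k.+1)%MS.
Proof.
rewrite (flag_dist_leqif W W').2; apply/forallP/andP => [maxW | [cap0 full] i].
  have size_t : size (iota 1 (k + k.+1).-1) = (k + k)%N.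
    by rewrite size_iota addnS.
  split; last first.
    (* Indices start at 0: index [k] is the level of dimension [k.+1], and index [k.-1] that of
       dimension [k]. *)
    have ltk : (k < size (iota 1 (k + k.+1).-1))%N by rewrite size_t; lia.
    have := maxW (Ordinal ltk); rewrite /= => /eqP rk.
    by rewrite /row_full rk; apply/eqP; lia.
  have ltk : (k.-1 < size (iota 1 (k + k.+1).-1))%N by rewrite size_t; lia.
  have := maxW (Ordinal ltk); rewrite /= prednK // => /eqP rk.
  have := mxrank_sum_cap (flag_nth W k) (flag_nth W' k).
  rewrite rk !rank_flag_nth -?mxrank_eq0; lia.
have lt_i : (i < (k + k.+1).-1)%N by have := ltn_ord i; rewrite {2}size_iota.
case: (ltnP i k) => ik.
  have : (flag_nth W i.+1 :&: flag_nth W' i.+1)%MS == 0.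
    by rewrite -submx0 -(eqP cap0) capmxS // flag_nthS //; lia.
  rewrite -mxrank_eq0 => /eqP cap_i.
  have := mxrank_sum_cap (flag_nth W i.+1) (flag_nth W' i.+1).
  by rewrite cap_i !rank_flag_nth; lia.
have : row_full (flag_nth W i.+1 + flag_nth W' i.+1)%MS.
  move: full; rewrite -!sub1mx => full. apply: (submx_trans full).
  by rewrite addsmxS // flag_nthS //; lia.
by rewrite /row_full => /eqP ->; lia.
Qed.

(** A minimum that reaches an upper bound of all distances forces every distance to equal it. Two
    members are required so that the default value 0 does not occur. *)
Lemma min_flag_dist_eqP (F : finFieldType) n t (C : {set flag F n t}) D :
  (forall W W' : flag F n t, flag_dist W W' <= D)%N -> (1 < #|C|)%N ->
  min_flag_dist C = D <->
  {in C &, forall W W', W != W' -> flag_dist W W' = D}.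
Proof.
move=> leD C_gt1; rewrite /min_flag_dist; set P := SimplPred _.
case: pickP => [e0 Pe0 | noP]; last first.
  case/card_gt1P: C_gt1 => W [W' [WC W'C neqW]].
  by have := noP (W, W'); rewrite /= WC W'C neqW.
case: arg_minnP => // e Pe min_e; split=> [distD W W' WC W'C neqW | distD].
  apply/eqP; rewrite eqn_leq leD -distD.
  by apply: (min_e (W, W')); rewrite /= WC W'C neqW.
by case/and3P: Pe => e1C e2C neqe; apply: distD.
Qed.

(** * Powers of the generator in block form *)

Section GLPowers.

Variable F : finFieldType.

(** For [n = 0] the group consists of 1 x 1 matrices, all sent by [GLmx] to the empty matrix; hence
    [0 < n]. *)
Lemma GLmx_eq1 n (A : {'GL_n[F]}) : (0 < n)%N -> (GLmx A == 1%:M) = (A == 1%g).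
Proof. by case: n A => // n A _; rewrite /GLmx conform_mx_id -val_eqE. Qed.

Lemma GLmx_exp_block m n (g : {'GL_(m + n.+1)[F]}) (M : 'M[F]_n.+1) i :
  GLmx g = block_mx 1%:M 0 0 M ->
  GLmx (g ^+ i)%g = block_mx 1%:M 0 0 (M ^+ i).
Proof.
move=> gE; elim: i => [|i IHi].
  by rewrite expg0 GLmx1 expr0 -scalar_mx_block.
rewrite expgSr GLmxM IHi gE mulmx_block !mulmx0 !mul0mx mulmx1 !addr0 add0r.
by rewrite exprSr.
Qed.

Lemma GLmx_exp_block_eq1 m n (g : {'GL_(m + n.+1)[F]}) (M : 'M[F]_n.+1) i :
  GLmx g = block_mx 1%:M 0 0 M -> (g ^+ i == 1)%g = (M ^+ i == 1).
Proof.
move=> gE; rewrite -GLmx_eq1 ?addnS // (GLmx_exp_block i gE) scalar_mx_block.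
by apply/eqP/eqP => [/eq_block_mx[_ _ _ ->] | -> //].
Qed.

End GLPowers.

(** * The middle levels of the flags of the code *)

Section PrimitiveOrbit.

Variables (F : finFieldType) (k : nat) (M : 'M[F]_k.+1).
Variable g : {'GL_(k + k.+1)[F]}.
Hypotheses (k_gt0 : (0 < k)%N) (primM : primitive_poly (char_poly M)).
Hypothesis gE : GLmx g = block_mx 1%:M 0 0 M.
Variables (U1 : 'M[F]_(k, k)) (U2 : 'M[F]_(k, k.+1)).
Variables (v1 : 'rV[F]_k) (v2 : 'rV[F]_k.+1).
Hypotheses (rkU1 : \rank U1 = k) (rkU2 : \rank U2 = k).
Hypothesis v2_notin : ~~ (v2 <= U2)%MS.

Let freeU1 : row_free U1. Proof. exact/eqP. Qed.
Let fullU1 : row_full U1. Proof. exact/eqP. Qed.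
Let freeU2 : row_free U2. Proof. exact/eqP. Qed.

Lemma order_primitive_block : #[g]%g = (#|F| ^ k.+1).-1.
Proof.
have gM i := GLmx_exp_block_eq1 i gE.
have v_gt0 : (0 < (#|F| ^ k.+1).-1)%N.
  by rewrite ltn_predRL -[X in (X < _)%N](expn0 #|F|) ltn_exp2l ?finNzRing_gt1.
have := @dvdn_leq #[g]%g _ v_gt0.
rewrite order_dvdn gM (expmx_primitive primM).
rewrite eqxx => /(_ isT); rewrite leq_eqVlt => /predU1P[//|lt_v].
have lt0v : (0 < #[g]%g < (#|F| ^ k.+1).-1)%N by rewrite order_gt0.
have := dvdnn #[g]%g; rewrite order_dvdn gM => Mv1.
by case/negP: (expmx_primitive_neq1 primM lt0v).
Qed.

(** Adjoining [v2] to the hyperplane [U2] spans the whole space. *)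
Lemma hyperplane_adjoin_ker p (h : 'M_(k.+1, p)) :
  U2 *m h = 0 -> v2 *m h = 0 -> h = 0.
Proof.
move=> U2h v2h; have full : row_full (U2 + v2)%MS.
  rewrite /row_full eqn_leq rank_leq_col -{1}rkU2.
  apply: rank_ltmx; rewrite /ltmx addsmxSl addsmx_sub submx_refl /=.
  exact: v2_notin.
rewrite -sub1mx addsmxE sub1mx in full.
by apply: (mulmx_row_full_eq0 full); rewrite mul_col_mx U2h v2h col_mx0.
Qed.

(** The left block [U1] forces equal coefficients, and the right block then has the invertible
    factor [M ^+ i - M ^+ j]. *)
Lemma orbit_capmx_eq0 i j : M ^+ i != M ^+ j ->
  (row_mx U1 (U2 *m M ^+ i) :&: row_mx U1 (U2 *m M ^+ j))%MS = 0.
Proof.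
move=> neq; apply: capmx_row_mx_eq0 => p a b /(row_free_inj freeU1) <- /eqP.
rewrite -subr_eq0 -!mulmxBr mulmxA => /eqP.
move/(mulmx_row_free_eq0 _)=> aU2; apply: (mulmx_row_free_eq0 freeU2).
by apply: aU2; rewrite row_free_unit; apply: expmx_primitive_sub_unit.
Qed.

Lemma orbit_capmx'_eq0 i :
  (row_mx U1 (U2 *m M ^+ i) :&: row_mx U1 (0 : 'M_(k, k.+1)))%MS = 0.
Proof.
apply: capmx_row_mx_eq0 => p a b _; rewrite mulmx0 mulmxA.
move/(mulmx_row_free_eq0 _)=> aU2; apply: (mulmx_row_free_eq0 freeU2).
by apply: aU2; rewrite row_free_unit; apply: expmx_primitive_unit.
Qed.

Lemma capmx''_eq0 (B : 'M_(k, k.+1)) :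
  (row_mx U1 B :&: row_mx (0 : 'M_(k, k)) U2)%MS = 0.
Proof.
apply: capmx_row_mx_eq0 => p a b; rewrite mulmx0 => aU1 _.
exact: mulmx_row_free_eq0 freeU1 aU1.
Qed.

(** Subtracting the equations of the two summands shows that [U2] and [v2] kill
    [(M ^+ i - M ^+ j) *m l]; thus [l = 0], and then [U1] gives [h = 0]. *)
Lemma orbit_addsmx_full i j : M ^+ i != M ^+ j ->
  row_full (block_mx U1 (U2 *m M ^+ i) 0 (v2 *m M ^+ i) +
            block_mx U1 (U2 *m M ^+ j) 0 (v2 *m M ^+ j))%MS.
Proof.
move=> neq; apply: row_full_adds_block => p h l.
rewrite !mul0mx !add0r => -[e1 e2 e3 e4].
have l0 : l = 0.
  have unitM := expmx_primitive_sub_unit primM neq.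
  apply: (@mulmx_row_full_eq0 _ _ _ _ (M ^+ i - M ^+ j)).
    by rewrite row_full_unit.
  apply: hyperplane_adjoin_ker; last first.
    by rewrite mulmxA mulmxBr mulmxBl e2 e4 subrr.
  apply/eqP; rewrite mulmxA mulmxBr mulmxBl subr_eq0; apply/eqP.
  by apply: (addrI (U1 *m h)); rewrite e1 e3.
split=> //; apply: (mulmx_row_full_eq0 fullU1).
by move: e1; rewrite l0 mulmx0 addr0.
Qed.

Lemma orbit_addsmx'_full i :
  row_full (block_mx U1 (U2 *m M ^+ i) 0 (v2 *m M ^+ i) +
            block_mx U1 0 0 v2)%MS.
Proof.
apply: row_full_adds_block => p h l.
rewrite !mul0mx addr0 !add0r => -[e1 e2 e3 e4].
have h0 : h = 0 by apply: (mulmx_row_full_eq0 fullU1).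
split=> //; apply: (@mulmx_row_full_eq0 _ _ _ _ (M ^+ i)).
  by rewrite row_full_unit; apply: expmx_primitive_unit.
apply: hyperplane_adjoin_ker; last by rewrite mulmxA.
by rewrite mulmxA; move: e1; rewrite h0 mulmx0 add0r.
Qed.

Lemma addsmx''_full (B : 'M_(k, k.+1)) (c : 'rV_k.+1) :
  row_full (block_mx U1 B 0 c + block_mx 0 U2 0 v2)%MS.
Proof.
apply: row_full_adds_block => p h l; rewrite !mul0mx !add0r => -[e1 _ e3 e4].
have l0 : l = 0 by apply: hyperplane_adjoin_ker.
split=> //; apply: (mulmx_row_full_eq0 fullU1).
by move: e1; rewrite l0 mulmx0 addr0.
Qed.

Lemma orbit_addsmx''_not_full : v1 != 0 -> exists i,
  ~~ row_full (block_mx U1 (U2 *m M ^+ i) v1 (v2 *m M ^+ i) +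
               block_mx 0 U2 v1 v2)%MS.
Proof.
move=> v1n0; have unitU1 : U1 \in unitmx by rewrite -row_free_unit.
pose w := v1 *m invmx U1.
have v1E : v1 = w *m U1 by rewrite /w mulmxKV.
have bU : (w *m U2 <= U2)%MS by exact: submxMl.
have bn0 : w *m U2 != 0.
  apply: contraNneq v1n0 => /(mulmx_row_free_eq0 freeU2) w0.
  by rewrite v1E w0 mul0mx.
have [i [aMi bMi]] := expmx_hyperplane k_gt0 primM rkU2 v2_notin bU bn0.
exists i; have [phi phin0 [inU _]] := hyperplane_eqn rkU2.
move: aMi bMi; rewrite !inU !mulmxBl !subr_eq0 => /eqP aMi /eqP bMi.
have U2phi : U2 *m phi = 0 by apply/eqP; rewrite -inU.
(* Chosen so that the form [col_mx h phi] vanishes on the rows of [row_mx U1 (U2 *m M ^+ i)]; the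
   two conditions on [i] make it vanish on the remaining rows. *)
pose h := - (invmx U1 *m U2 *m M ^+ i *m phi).
have U1h : U1 *m h = - (U2 *m M ^+ i *m phi).
  by rewrite /h mulmxN !mulmxA mulmxV // mul1mx.
have v1h : v1 *m h = - (w *m U2 *m M ^+ i *m phi).
  by rewrite v1E -mulmxA U1h mulmxN !mulmxA.
apply/negP => full; have : col_mx h phi = 0.
  apply: (row_full_adds_cokernel full); rewrite mul_block_col.
    by rewrite U1h v1h aMi !addNr col_mx0.
  by rewrite mul0mx add0r U2phi v1h bMi addNr col_mx0.
by move/eqP; rewrite col_mx_eq0 (negPf phin0) andbF.
Qed.

End PrimitiveOrbit.

(** * The orbit together with the two additional flags *)

Theorem theorem5p11 (F : finFieldType) (k : nat) (k_gt1 : (1 < k)%N)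
    (p : {poly F}) (p_prim : primitive_poly p) (p_deg : (size p).-1 = k.+1)
    (g : {'GL_(k + k.+1)[F]})
    (gE : GLmx g = block_mx 1%:M 0 0 (castmx (p_deg, p_deg) (companionmx p)))
    (U1 : 'M[F]_(k, k)) (U2 : 'M[F]_(k, k.+1))
    (rkU1 : \rank U1 = k) (rkU2 : \rank U2 = k)
    (v1 : 'rV[F]_k) (v2 : 'rV[F]_k.+1) (v2_notin : ~~ (v2 <= U2)%MS)
    (W W' W'' : full_flag F (k + k.+1))
    (Wk : flag_nth W k = <<row_mx U1 U2>>%MS)
    (Wk1 : flag_nth W k.+1 = <<block_mx U1 U2 v1 v2>>%MS)
    (W'k : flag_nth W' k = <<row_mx U1 0>>%MS)
    (W'k1 : flag_nth W' k.+1 = <<block_mx U1 0 v1 v2>>%MS)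
    (W''k : flag_nth W'' k = <<row_mx 0 U2>>%MS)
    (W''k1 : flag_nth W'' k.+1 = <<block_mx 0 U2 v1 v2>>%MS) :
  let C := orbit (flag_action F _ _) <[g]>%g W :|: [set W'; W''] in
  (optimum_distance C /\ #|C| = (#|F| ^ k.+1 + 1)%N) <-> v1 = 0.
Proof.
move=> C; have k_gt0 : (0 < k)%N by exact: ltnW.
have pM : p \is monic by case/primitive_polyP: p_prim => -[].
set M : 'M[F]_k.+1 := castmx _ _ in gE.
have primM : primitive_poly (char_poly M).
  by rewrite /M char_poly_castmx companionmxK.
have lt_k : (0 < k < k + k.+1)%N by lia.
have lt_k1 : (0 < k.+1 < k + k.+1)%N by lia.
pose Wg i : full_flag F (k + k.+1) := flag_act W (g ^+ i)%g.
have WgE i : flag_nth (Wg i) k = <<row_mx U1 (U2 *m M ^+ i)>>%MS.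
  rewrite flag_nth_act // Wk (GLmx_exp_block i gE).
  apply/eq_genmx/(eqmx_trans (eqmxMr _ (genmxE _))).
  by rewrite mul_row_block !mulmx0 mulmx1 addr0 add0r; exact: eqmx_refl.
have Wg1E i : flag_nth (Wg i) k.+1 =
    <<block_mx U1 (U2 *m M ^+ i) v1 (v2 *m M ^+ i)>>%MS.
  rewrite flag_nth_act // Wk1 (GLmx_exp_block i gE).
  apply/eq_genmx/(eqmx_trans (eqmxMr _ (genmxE _))).
  by rewrite mulmx_block !mulmx0 !mulmx1 !addr0 !add0r; exact: eqmx_refl.
have CP V : reflect ((exists i, V = Wg i) \/ V = W' \/ V = W'') (V \in C).
  rewrite !inE; apply: (iffP or3P).
    case=> [/orbitP[a /cycleP[i ->] <-] | /eqP-> | /eqP->]; last 2 first.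
    - by right; left.
    - by right; right.
    by left; exists i.
  case=> [[i ->] | [-> | ->]]; last 2 first.
  - by constructor 2.
  - by constructor 3.
  by constructor 1; exact: (mem_orbit (flag_action F _ _) W (mem_cycle g i)).
have capE m1 m2 (A : 'M[F]_(m1, k + k.+1)) (B : 'M[F]_(m2, k + k.+1)) :
    (A :&: B)%MS = 0 -> ((<<A>> :&: <<B>>)%MS == 0).
  by move=> AB0; rewrite -submx0 (cap_eqmx (genmxE A) (genmxE B)) AB0 sub0mx.
have addsE m1 m2 (A : 'M[F]_(m1, k + k.+1)) (B : 'M[F]_(m2, k + k.+1)) :
    row_full (<<A>> + <<B>>)%MS = row_full (A + B)%MS.
  by rewrite -!sub1mx (adds_eqmx (genmxE A) (genmxE B)).
have gM i j : Wg i != Wg j -> M ^+ i != M ^+ j.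
  apply: contraNneq => eqM; apply/eqP; rewrite /Wg; congr flag_act.
  apply: (mulIg (g ^+ j)^-1%g); rewrite mulgV; apply/eqP.
  rewrite -GLmx_eq1 ?addnS // GLmxM (GLmx_exp_block i gE) eqM.
  by rewrite -(GLmx_exp_block j gE) GLmxK.
have cap_g i j : M ^+ i != M ^+ j ->
    (flag_nth (Wg i) k :&: flag_nth (Wg j) k)%MS == 0.
  by move=> neq; rewrite !WgE; apply/capE/orbit_capmx_eq0.
have cap_g' i : (flag_nth (Wg i) k :&: flag_nth W' k)%MS == 0.
  by rewrite WgE W'k; apply/capE/orbit_capmx'_eq0.
have cap_g'' i : (flag_nth (Wg i) k :&: flag_nth W'' k)%MS == 0.
  by rewrite WgE W''k; apply/capE/capmx''_eq0.
have cap'_'' : (flag_nth W' k :&: flag_nth W'' k)%MS == 0.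
  by rewrite W'k W''k; apply/capE/capmx''_eq0.
(* A subspace of positive dimension [k] does not meet itself trivially. *)
have neq_cap (V V' : full_flag F (k + k.+1)) :
    (flag_nth V k :&: flag_nth V' k)%MS == 0 -> V != V'.
  apply: contraTneq => ->; rewrite -submx0.
  apply/negP => cap0.
  have : (flag_nth V' k <= flag_nth V' k :&: flag_nth V' k)%MS.
    by rewrite sub_capmx !submx_refl.
  move/submx_trans/(_ cap0); rewrite submx0 -mxrank_eq0 rank_flag_nth //.
  by rewrite eqn0Ngt k_gt0.
have W'C : W' \in C by apply/CP; right; left.
have W''C : W'' \in C by apply/CP; right; right.
have C_gt1 : (1 < #|C|)%N.
  by apply/card_gt1P; exists W', W''; split=> //; apply: neq_cap.
have optP := min_flag_dist_eqP (fun V V' => (flag_dist_leqif V V').1) C_gt1.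
split=> [[/optP distC _] | v1_0].
  (* If [v1] is nonzero, some orbit flag and [W''] fail to span at level [k.+1], so their distance
     is not optimal. *)
  apply: contraTeq isT => v1n0.
  have [i] := orbit_addsmx''_not_full k_gt0 primM rkU1 rkU2 v2_notin v1n0.
  have WgC : Wg i \in C by apply/CP; left; exists i.
  have /eqP := distC _ _ WgC W''C (neq_cap _ _ (cap_g'' i)).
  by rewrite flag_dist_middle // Wg1E W''k1 addsE => /andP[_ ->].
have full_g i j : M ^+ i != M ^+ j ->
    row_full (flag_nth (Wg i) k.+1 + flag_nth (Wg j) k.+1)%MS.
  by move=> neq; rewrite !Wg1E addsE v1_0; apply: orbit_addsmx_full.
have full_g' i : row_full (flag_nth (Wg i) k.+1 + flag_nth W' k.+1)%MS.
  by rewrite Wg1E W'k1 addsE v1_0; apply: orbit_addsmx'_full.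
have full_g'' i : row_full (flag_nth (Wg i) k.+1 + flag_nth W'' k.+1)%MS.
  by rewrite Wg1E W''k1 addsE v1_0; apply: addsmx''_full.
have full'_'' : row_full (flag_nth W' k.+1 + flag_nth W'' k.+1)%MS.
  by rewrite W'k1 W''k1 addsE v1_0; apply: addsmx''_full.
split.
  apply/optP => V V' /CP VC /CP V'C neqV; apply/eqP.
  rewrite flag_dist_middle //; apply/andP.
  have capC U U' : (flag_nth U k :&: flag_nth U' k)%MS == 0 ->
      (flag_nth U' k :&: flag_nth U k)%MS == 0 by rewrite capmxC.
  have addC U U' : row_full (flag_nth U k.+1 + flag_nth U' k.+1)%MS ->
      row_full (flag_nth U' k.+1 + flag_nth U k.+1)%MS by rewrite addsmxC.
  (* Nine cases: equal extra flags are excluded by [neq], and symmetry covers the reversed pairs. *)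
  case: VC V'C neqV => [[i ->] | [-> | ->]] [[j ->] | [-> | ->]] neq;
    rewrite ?eqxx in neq => //; split; auto.
(* A power with [M ^+ i != 1] moves the [k]-th subspace to one meeting it trivially, so it cannot
   fix [W]. *)
have stabW : 'C_<[g]>[W | flag_action F _ _]%g = 1%g.
  apply/trivgP/subsetP => a /setIP[/cycleP[i ->] /astab1P].
  rewrite [flag_action _ _ _ _ _]/= -/(Wg i) inE => fixW.
  rewrite (GLmx_exp_block_eq1 i gE); apply: contra_eqT fixW => Mi.
  rewrite -[W in _ != W]flag_act1 -[1%g](expg0 g) -/(Wg 0).
  by apply/neq_cap/cap_g; rewrite expr0.
rewrite /C cardsU disjoint_setI0; last first.
  apply/pred0P => V /=; apply/negP => /andP[/orbitP[a /cycleP[i ->] <-]].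
  rewrite [flag_action _ _ _ _ _]/= -/(Wg i) !inE.
  by rewrite !(negPf (neq_cap _ _ _)).
(* The orbit has as many flags as the order of [g], one less than [#|F| ^ k.+1]; the two extra flags
   bring the total to one more. *)
rewrite cards0 subn0 cards2 neq_cap // card_orbit stabW indexg1.
rewrite -[#|_|]/(#[g]%g) (order_primitive_block primM gE).
rewrite addnS -[in RHS](prednK (n := #|F| ^ k.+1)) ?addn1 //.
by rewrite expn_gt0 ltnW // finNzRing_gt1.
Qed.
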